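(* Let $1\le p<\infty$, let $\Omega\subset\mathbb{R}^d$ be open and bounded, and let $\nu:\mathbb{R}^d\setminus\{0\}\to[0,\infty)$ be measurable and symmetric ($\nu(h)=\nu(-h)$). Assume there is $r>0$ such that $$\kappa:=\operatorname*{ess\,inf}_{h\in B_r(0)}\nu(h)>0 .$$ If $r\ge\operatorname{diam}(\Omega)$, or else $\Omega$ is $\rho$-connected with $r>\rho\ge0$, then there is $C=C(d,p,\Omega,\nu)>0$ such that $$\Big\|u-\frac{1}{|\Omega|}\int_\Omega u\,dx\Big\|^p_{L^p(\Omega)}\le C\,\mathcal{E}_\Omega(u,u)\qquad\text{for all }u\in L^p(\Omega).$$
   Context: $\mathcal{E}_\Omega(u,u)=\int_\Omega\int_\Omega|u(x)-u(y)|^p\nu(x-y)\,dy\,dx\in[0,\infty]$. For $\rho\ge0$, $\Omega$ is called $\rho$-connected if $\Omega=\Omega_1\cup\dots\cup\Omega_m$ for some $m\ge1$, where each $\Omega_i$ is open and connected and $\operatorname{dist}(\Omega_i,\Omega_{i+1})<\rho$ for $i=1,\dots,m-1$ (so every connected open set is $0$-connected, taking $m=1$). $\operatorname{dist}(A,B)=\inf\{|x-y|:x\in A,y\in B\}$. *)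

(* Defs.v *)
From HB Require Import structures.
From mathcomp Require Import all_boot all_order all_algebra.
From mathcomp Require Import all_classical all_reals all_analysis.

Set Implicit Arguments.
Unset Strict Implicit.
Unset Printing Implicit Defensive.

Import Order.TTheory GRing.Theory Num.Theory.
Import numFieldNormedType.Exports.

Local Open Scope classical_set_scope.
Local Open Scope ring_scope.

(* R^d is 'rV[R]_d; a positive dimension is written d.+1. Its topology is the
   library's product topology, but the library's norm on matrices is the
   sup norm, so the Euclidean norm is defined here. *)
Section euclidean.
Context (R : realType) (d : nat).
Implicit Types (x : 'rV[R]_d) (A B : set 'rV[R]_d).

Definition enorm x : R := Num.sqrt (\sum_(i < d) x ord0 i ^+ 2).

Definition eball (r : R) : set 'rV[R]_d := [set h | enorm h < r].

Definition ebounded A := exists M : R, forall x, A x -> enorm x <= M.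

(* -oo for the empty set *)
Definition ediam A : \bar R :=
  ereal_sup [set (enorm (z.1 - z.2))%:E | z in A `*` A].

(* +oo if one of the sets is empty *)
Definition edist A B : \bar R :=
  ereal_inf [set (enorm (z.1 - z.2))%:E | z in A `*` B].

Definition rho_connected (rho : R) (Omega : set 'rV[R]_d) :=
  exists (m : nat) (A : nat -> set 'rV[R]_d),
    [/\ (0 < m)%N,
        Omega = \bigcup_(i < m) A i,
        forall i, (i < m)%N -> open (A i) /\ connected (A i) &
        forall i, (i.+1 < m)%N -> (edist (A i) (A i.+1) < rho%:E)%E].

End euclidean.

(* Lebesgue measure on R^(d+1): the Lebesgue outer measure defined by countable
   covers by open boxes, restricted to its Caratheodory measurable sets. In
   particular "measurable" means Lebesgue measurable, and not just Borel. *)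
Section lebesgue_outer_measure.
Context (R : realType) (d : nat).
Local Notation V := 'rV[R]_d.+1.
Local Open Scope ereal_scope.

Definition box (c : V * V) : set V :=
  [set x | forall i, (c.1 ord0 i < x ord0 i < c.2 ord0 i)%R].

Definition box_volume (c : V * V) : \bar R :=
  (\prod_(i < d.+1) Num.max 0 (c.2 ord0 i - c.1 ord0 i))%:E.

Definition lebesgue_outer (A : set V) : \bar R :=
  ereal_inf [set \sum_(k <oo) box_volume (c k) |
             c in [set c : nat -> V * V | A `<=` \bigcup_k box (c k)]].

Lemma box_volume_ge0 c : 0 <= box_volume c.
Proof. by rewrite lee_fin; apply: prodr_ge0 => i _; rewrite le_max lexx. Qed.

Lemma lebesgue_outer_ge0 A : 0 <= lebesgue_outer A.
Proof.
apply: le_ereal_inf_tmp => _ [c _ <-]; apply: nneseries_ge0 => *.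
exact: box_volume_ge0.
Qed.

Lemma lebesgue_outer0 : lebesgue_outer set0 = 0.
Proof.
apply/eqP; rewrite eq_le lebesgue_outer_ge0 andbT.
apply: ereal_inf_lbound; exists (fun=> (0%R, 0%R)); first exact: sub0set.
apply: eseries0 => i _ _; rewrite /box_volume /= big_ord_recl.
by rewrite subrr maxxx mul0r.
Qed.

Lemma le_lebesgue_outer :
  {homo lebesgue_outer : A B / A `<=` B >-> A <= B}.
Proof.
move=> A B AB; apply: ereal_inf_le_tmp => _ [c Bc <-].
by exists c => //; exact: subset_trans Bc.
Qed.

Lemma lebesgue_outer_sigma_subadditive : sigma_subadditive lebesgue_outer.
Proof.
move=> A; have [[i ioo]|] := pselect (exists i, lebesgue_outer (A i) = +oo).
  rewrite (eseries_pinfty _ _ ioo) ?leey// => n _.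
  by rewrite -ltNye (lt_le_trans _ (lebesgue_outer_ge0 _)).
rewrite -forallNE => Aoo.
suff add2e (e : {posnum R}) : lebesgue_outer (\bigcup_n A n) <=
    \sum_(i <oo) lebesgue_outer (A i) + e%:num%:E.
  by apply/lee_addgt0Pr => _/posnumP[].
rewrite (le_trans _ (epsilon_trick _ _ _))//; last first.
  by move=> n; exact: lebesgue_outer_ge0.
pose P n (c : nat -> V * V) := A n `<=` \bigcup_k box (c k) /\
  \sum_(k <oo) box_volume (c k) <=
    lebesgue_outer (A n) + (e%:num / (2 ^ n.+1)%:R)%:E.
have [G PG] : {G : nat -> nat -> V * V & forall n, P n (G n)}.
  apply: (@choice _ _ P) => n; rewrite /P /lebesgue_outer.
  set S := (X in ereal_inf X); move infS : (ereal_inf S) => iS.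
  case: iS infS => [r Sr|Soo|Soo].
  - have en1 : (0 < e%:num / (2 ^ n.+1)%:R)%R by [].
    have /(lb_ereal_inf_adherent en1) : ereal_inf S \is a fin_num by rewrite Sr.
    move=> [_ [c Ac <-] xS].
    by exists c; split => //; rewrite -Sr; exact/ltW.
  - by have := Aoo n; rewrite /lebesgue_outer Soo.
  - suff : lbound S 0 by move/le_ereal_inf_tmp; rewrite Soo.
    move=> /= _ [c _ <-]; apply: nneseries_ge0 => *; exact: box_volume_ge0.
have muG_ge0 x : 0 <= (box_volume \o uncurry G) x by exact: box_volume_ge0.
apply: (@le_trans _ _ (\esum_(i in setT) (box_volume \o uncurry G) i)).
  apply: ereal_inf_lbound => /=.
  have /card_esym/ppcard_eqP[f] := card_nat2.
  exists (uncurry G \o f).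
    apply: (@subset_trans _  (\bigcup_n \bigcup_k box (G n k))) => [t [i _]|].
      by move=> /(PG i).1 -[j _ ?]; exists i => //; exists j.
    move=> t [i _ [j _ Bijt]]; exists (f^-1%FUN (i, j)) => //=.
    by rewrite invK ?inE.
  rewrite -(esum_pred_image (box_volume \o uncurry G) _ xpredT) ?[fun=> _]set_true//.
  by rewrite image_eq.
rewrite (_ : esum _ _ = \sum_(i <oo) \sum_(j <oo) box_volume (G i j)); last first.
  pose J : nat -> set (nat * nat) := fun i => [set (i, j) | j in setT].
  rewrite (_ : setT = \bigcup_k J k); last first.
    by rewrite predeqE => -[a b]; split => // _; exists a => //; exists b.
  rewrite esum_bigcupT //=; last first.
    apply/trivIsetP => i j _ _ ij.
    rewrite predeqE => -[n m] /=; split => //= -[] [_] _ [<-{n} _].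
    by move=> [m' _] [] /esym/eqP; rewrite (negbTE ij).
  rewrite -(image_id [set: nat]) -fun_true esum_pred_image//; last first.
    by move=> n _; apply: esum_ge0 => x _; exact: muG_ge0.
  apply: eq_eseriesr => /= j _.
  rewrite -(esum_pred_image (box_volume \o uncurry G) (pair j) predT)//; last first.
    by move=> ? ? _ _; exact: (@can_inj _ _ _ snd).
  by congr esum; rewrite predeqE => -[a b]; split; move=> [i _ <-]; exists i.
apply: lee_lim.
- apply: is_cvg_nneseries => n *.
  by apply: nneseries_ge0 => m *; exact: (muG_ge0 (n, m)).
- apply: is_cvg_nneseries => n *; apply: adde_ge0 => //.
  exact: lebesgue_outer_ge0.
- by near=> n; apply: lee_sum => i _; exact: (PG i).2.
Unshelve. all: by end_near. Qed.

HB.instance Definition _ := isOuterMeasure.Build R V lebesgue_outer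
  lebesgue_outer0 lebesgue_outer_ge0 le_lebesgue_outer
  lebesgue_outer_sigma_subadditive.

HB.instance Definition _ := Measurable.copy V (caratheodory_type lebesgue_outer).

Definition lebesgue : set V -> \bar R := lebesgue_outer.

HB.instance Definition _ := isMeasure.Build _ V R lebesgue
  (@caratheodory_measure0 R V lebesgue_outer)
  (@caratheodory_measure_ge0 R V lebesgue_outer)
  (@caratheodory_measure_sigma_additive R V lebesgue_outer).

End lebesgue_outer_measure.

Section nonlocal_energy.
Context (R : realType) (d : nat).
Local Notation V := 'rV[R]_d.+1.
Local Notation leb := (@lebesgue R d).
Implicit Types (Omega : set V) (p : R) (nu u : V -> R).
Local Open Scope ereal_scope.

Definition ess_inf_on (A : set V) (f : V -> \bar R) : \bar R :=
  ereal_sup [set y | \forall x \ae leb, A x -> y <= f x].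

Definition Lp_norm Omega p u : \bar R := 'N[leb]_p%:E[(EFin \o u) \_ Omega].

Definition in_Lp Omega p u :=
  measurable_fun Omega u /\ Lp_norm Omega p u < +oo.

Definition mean Omega u : R :=
  ((fine (leb Omega))^-1 * \int[leb]_(x in Omega) u x)%R.

Definition energy Omega p nu u : \bar R :=
  \int[leb]_(x in Omega) \int[leb]_(y in Omega)
    (`|u x - u y| `^ p * nu (x - y))%:E.

End nonlocal_energy.

(* Main.v *)
Require Import Defs.
From mathcomp Require Import all_boot all_order all_algebra.
From mathcomp Require Import all_classical all_reals all_analysis.
From mathcomp Require Import measurable_realfun.
From mathcomp Require Import ring lra.
Import Order.TTheory GRing.Theory Num.Theory.
Import numFieldNormedType.Exports.
Local Open Scope classical_set_scope.
Local Open Scope ring_scope.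

(** The kernel is bounded below by some kappa > 0 on a punctured ball of radius
    r, so the energy controls the local integrals of |u x - u y|^p over pairs of
    points at distance less than r.  The proof spreads this local control over
    Omega by a chain argument.

    Fix measurable sets F and G inside Omega, F of positive measure, all points
    of G being at distance less than r from all points of F.  Integrating
    |u x - a|^p <= 2^p (|u x - u y|^p + |u y - a|^p) over y in F and then over x
    in G bounds the deviation of u from a on G by its deviation from a on F plus
    a multiple of the energy ([deviation_transfer]).  When G = F, Jensen's
    inequality starts the chain: the deviation of u on F from its average on F
    is bounded by the energy ([deviation_average_le]).  If r is at least the
    diameter of Omega, take F = Omega and stop here.

    Otherwise consider the traces E x on Omega of small balls with centres x in
    Omega, and take for a the average of u on one of them, E x0.  By transfer,
    the set of the centres x for which the deviation from a on E x is bounded by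
    the energy is stable under steps of length slightly more than rho inside
    Omega; rho-connectedness makes it all of Omega ([rho_connected_steps]).
    Since Omega is bounded, finitely many E x cover it
    ([bounded_finite_cover]), so the deviation from a on Omega is bounded by the
    energy, and replacing a by the average on Omega costs only a constant factor
    ([controlled_average_Omega]).

    Two points of measure theory deserve mention.  Integrals of arbitrary
    nonnegative functions are suprema over simple functions, hence monotone
    ([ge0_le_lower_integral]); the inner integral of the energy, as a function
    of x, only enters as the larger side of such a comparison with a measurable
    function.  And the facts on the Lebesgue measure of R^(d+1) come from its
    definition by coverings with boxes: open sets are measurable, and of
    positive measure when nonempty ([open_lebesgue_measurable],
    [lebesgue_open_gt0]), and null sets are preserved by the reflections
    y |-> x - y ([outer_reflect_null]), which carry the bound on nu from almost
    every h to almost every y with h = x - y. *)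

Set Implicit Arguments.
Unset Strict Implicit.
Unset Printing Implicit Defensive.

(** * Inequalities for powers *)

Section power_inequalities.
Context (R : realType).
Implicit Types a b p t : R.

Lemma powRD_le p a b : 1 <= p ->
  `|a + b| `^ p <= 2 `^ p * (`|a| `^ p + `|b| `^ p).
Proof.
move=> p1; have p0 : 0 <= p by apply: le_trans p1.
wlog ab : a b / `|a| <= `|b|.
  move=> H; have [/H//|/ltW/H] := leP `|a| `|b|.
  by rewrite addrC [X in _ * X]addrC.
have : `|a + b| `^ p <= (2 * `|b|) `^ p.
  apply: ge0_ler_powR => //; rewrite ?nnegrE ?mulr_ge0//.
  by rewrite (le_trans (ler_normD _ _))// mulr_natl mulr2n lerD2r.
move=> /le_trans; apply; rewrite powRM// ler_wpM2l ?powR_ge0// lerDr.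
exact: powR_ge0.
Qed.

(** The convex function t |-> t^p lies above its tangent at a; this is Young's
    inequality for the product of t and a^(p-1). *)
Lemma powR_tangent p a t : 1 <= p -> 0 <= a -> 0 <= t ->
  p * a `^ (p - 1) * t <= t `^ p + (p - 1) * a `^ p.
Proof.
rewrite le_eqVlt => /predU1P[<- a0 t0|p1 a0 t0].
  by rewrite subrr powRr0 mul0r addr0 powRr1// !mul1r.
have p0 : 0 < p by apply: lt_trans p1.
have q0 : 0 < p / (p - 1) by rewrite divr_gt0// subr_gt0.
have := @conjugate_powR R t (a `^ (p - 1)) p (p / (p - 1)) t0 (powR_ge0 _ _) p0 q0.
have -> : p^-1 + (p / (p - 1))^-1 = 1.
  by rewrite invf_div -{1}(mul1r p^-1) -mulrDl addrC subrK divff// gt_eqF.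
move=> /(_ erefl).
have p1n0 : p - 1 != 0 by rewrite gt_eqF// subr_gt0.
have pn0 : p != 0 by rewrite gt_eqF.
rewrite -powRrM.
have -> : (p - 1) * (p / (p - 1)) = p by field.
move=> H; have := ler_wpM2l (ltW p0) H.
have -> : p * (t * a `^ (p - 1)) = p * a `^ (p - 1) * t by ring.
have -> : p * (t `^ p / p + a `^ p / (p / (p - 1))) = t `^ p + (p - 1) * a `^ p.
  by field; rewrite ?pn0 ?p1n0.
by [].
Qed.

End power_inequalities.

(** * Monotonicity of lower integrals *)

Section lower_integral.
Context d (T : measurableType d) (R : realType).
Variable mu : {measure set T -> \bar R}.
Local Open Scope ereal_scope.
Import HBNNSimple.

(** The integral of a nonnegative function is a supremum over the simple
    functions below it, so it is monotone even for non-measurable functions. *)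
Lemma ge0_le_lower_integral (D E : set T) (f g : T -> \bar R) :
  (forall x, D x -> 0 <= f x) -> (forall x, E x -> 0 <= g x) ->
  D `<=` E -> (forall x, D x -> f x <= g x) ->
  \int[mu]_(x in D) f x <= \int[mu]_(x in E) g x.
Proof.
move=> f0 g0 DE fg; rewrite !ge0_integralE//.
apply: le_ereal_sup => _ [h /= hf <-]; exists h => //= x.
apply: le_trans (hf x) _; rewrite !patchE; case: ifPn => [|_].
  by rewrite inE => Dx; rewrite ifT ?fg// inE; exact: DE.
by case: ifPn => // /[!inE]; exact: g0.
Qed.

(** A null set can only be discarded from the integral of a measurable function;
    here it is discarded from the smaller one. *)
Lemma ge0_ae_le_lower_integral (D E : set T) (f g : T -> \bar R) :
  measurable D -> measurable_fun D f ->
  (forall x, D x -> 0 <= f x) -> (forall x, E x -> 0 <= g x) ->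
  D `<=` E -> {ae mu, forall x, D x -> f x <= g x} ->
  \int[mu]_(x in D) f x <= \int[mu]_(x in E) g x.
Proof.
move=> mD mf f0 g0 DE [N [mN N0 fgN]].
rewrite (ge0_negligible_integral mN)//.
apply: ge0_le_lower_integral => //.
- by move=> x [/f0].
- by move=> x [/DE].
by move=> x [Dx Nx]; apply: contrapT => fg; apply: Nx; apply: fgN => /= H; exact: fg (H Dx).
Qed.

End lower_integral.

(** * p-th powers on sets of finite measure *)

Section lp_finite_measure.
Context d (T : measurableType d) (R : realType).
Variable mu : {measure set T -> \bar R}.
Variables (p : R) (p1 : 1 <= p).
Local Open Scope ereal_scope.
Implicit Types (F G : set T) (w : T -> R).

Lemma measurable_powR_norm F w : measurable_fun F w ->
  measurable_fun F (fun x => (`|w x| `^ p)%:E).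
Proof.
move=> mw; apply/measurable_EFinP; apply: (measurableT_comp (measurable_powR p)).
exact: measurableT_comp.
Qed.

Lemma powR_norm_ge0 w x : 0 <= (`|w x| `^ p)%:E.
Proof. by rewrite lee_fin powR_ge0. Qed.
Local Hint Resolve powR_norm_ge0 : core.

Lemma integrable_cst_lty F (r : R) : measurable F -> mu F < +oo ->
  mu.-integrable F (EFin \o cst r).
Proof.
move=> mF Foo; apply/integrableP; split; first exact/measurable_EFinP.
rewrite (_ : (fun x => _) = cst `|r|%:E)//.
by rewrite integral_cst// lte_mul_pinfty// lee_fin.
Qed.

(** By the tangent inequality at 1, |w| <= |w|^p + p. *)
Lemma lp_integrable F w : measurable F -> mu F < +oo -> measurable_fun F w ->
  \int[mu]_(x in F) (`|w x| `^ p)%:E < +oo -> mu.-integrable F (EFin \o w).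
Proof.
move=> mF Foo mw woo; apply/integrableP; split; first exact/measurable_EFinP.
apply: (@le_lt_trans _ _
  (\int[mu]_(x in F) ((`|w x| `^ p)%:E + (cst p%:E x)))).
  apply: ge0_le_integral => //.
  - by do 2 apply: measurableT_comp => //.
  - by apply: emeasurable_funD => //; exact: measurable_powR_norm.
  move=> x _; rewrite /= -EFinD lee_fin.
  have := powR_tangent p1 ler01 (normr_ge0 (w x)).
  rewrite !powR1 !mulr1; have := normr_ge0 (w x); move: p1.
  by move: (`|w x|)%R (_ `^ _)%R => a b; nra.
rewrite ge0_integralD//; last 2 first.
- exact: measurable_powR_norm.
- by move=> x _; rewrite lee_fin (le_trans ler01).
by rewrite lte_add_pinfty// integral_cst// lte_mul_pinfty// lee_fin (le_trans ler01).
Qed.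

Lemma lp_subr_cst_lty F w c : measurable F -> mu F < +oo -> measurable_fun F w ->
  \int[mu]_(x in F) (`|w x| `^ p)%:E < +oo ->
  \int[mu]_(x in F) (`|w x - c| `^ p)%:E < +oo.
Proof.
move=> mF Foo mw woo.
apply: (@le_lt_trans _ _ (\int[mu]_(x in F)
    ((2 `^ p)%:E * (`|w x| `^ p)%:E + (cst (2 `^ p * `|c| `^ p)%:E x)))).
  apply: ge0_le_integral => //.
  - by apply: measurable_powR_norm; exact: measurable_funB.
  - apply: emeasurable_funD => //; apply: measurable_funeM.
    exact: measurable_powR_norm.
  move=> x _; rewrite /= -EFinM -EFinD lee_fin -mulrDr.
  by have := powRD_le (w x) (- c) p1; rewrite normrN.
have p20 : (0 <= 2 `^ p)%R by exact: powR_ge0.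
rewrite ge0_integralD//; last 2 first.
- by apply: measurable_funeM; exact: measurable_powR_norm.
- by move=> x _; rewrite lee_fin mulr_ge0// powR_ge0.
rewrite lte_add_pinfty//.
  rewrite ge0_integralZl//; first by rewrite lte_mul_pinfty// lee_fin.
  exact: measurable_powR_norm.
by rewrite integral_cst// lte_mul_pinfty// lee_fin mulr_ge0// powR_ge0.
Qed.

(** Integrate the tangent inequality for t = |w x| at the point a, the average
    of |w|: the linear term integrates to zero. *)
Lemma jensen_powR F w : measurable F -> mu F < +oo -> measurable_fun F w ->
  \int[mu]_(x in F) (`|w x| `^ p)%:E < +oo ->
  mu F * (`|(fine (mu F))^-1 * \int[mu]_(x in F) w x|%R `^ p)%:E
    <= \int[mu]_(x in F) (`|w x| `^ p)%:E.
Proof.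
move=> mF Foo mw woo.
have [F0|F0] := eqVneq (mu F) 0.
  by rewrite F0 mul0e integral_ge0.
have Ffin : mu F \is a fin_num by rewrite ge0_fin_numE.
have iw := lp_integrable mF Foo mw woo.
have m0 : (0 < fine (mu F))%R by rewrite fine_gt0// Foo lt0e F0 measure_ge0.
set m := fine (mu F) in m0 *.
have -> : mu F = m%:E by rewrite fineK.
pose L := (\int[mu]_(x in F) `|w x|)%R.
have L0 : (0 <= L)%R by apply: Rintegral_ge0.
have LE : \int[mu]_(x in F) (`|w x|)%:E = L%:E.
  rewrite /L /Rintegral fineK//; apply: integrable_fin_num => //.
  exact: (integrable_norm iw).
pose a := (m^-1 * L)%R.
have a0 : (0 <= a)%R by rewrite mulr_ge0// invr_ge0 ltW.
have p10 : (0 <= p - 1)%R by rewrite subr_ge0.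
have p0 : (0 <= p)%R by exact: le_trans p1.
have Hw : (`|m^-1 * \int[mu]_(x in F) w x| <= a)%R.
  have im0 : (0 <= m^-1)%R by rewrite invr_ge0 ltW.
  rewrite /a normrM (ger0_norm im0); apply: ler_wpM2l => //.
  exact: le_normr_Rintegral.
apply: (@le_trans _ _ (m%:E * (a `^ p)%:E)).
  rewrite lee_pmul2l// lee_fin ge0_ler_powR//.
have key : (p * a `^ (p - 1) * L)%:E <=
    \int[mu]_(x in F) (`|w x| `^ p)%:E + ((p - 1) * a `^ p * m)%:E.
  rewrite EFinM -LE -ge0_integralZl//; last 2 first.
  - by apply/measurable_EFinP; exact: measurableT_comp.
  - by rewrite lee_fin mulr_ge0// powR_ge0.
  rewrite [X in _ + X]EFinM -[X in _ * X](_ : mu F = _); last by rewrite fineK.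
  rewrite -(integral_cst mu mF) -ge0_integralD//; last 2 first.
  - exact: measurable_powR_norm.
  - by move=> x _; rewrite lee_fin mulr_ge0// powR_ge0.
  apply: ge0_le_integral => //.
  - by move=> x _; rewrite -EFinM lee_fin mulr_ge0// mulr_ge0// powR_ge0.
  - by apply: measurable_funeM; apply/measurable_EFinP; exact: measurableT_comp.
  - by apply: emeasurable_funD => //; exact: measurable_powR_norm.
  by move=> x _; rewrite /= -EFinM -EFinD lee_fin powR_tangent.
have LEa : (L = m * a)%R by rewrite /a mulrA divff ?mul1r// gt_eqF.
have aE : (a `^ (p - 1) * a = a `^ p)%R.
  have [->|an0] := eqVneq a 0%R.
    by rewrite mulr0 powR0// gt_eqF// (lt_le_trans ltr01).
  rewrite -[X in (_ * X)%R](powRr1 a0) -powRD ?subrK//.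
  by rewrite an0 implybT.
move: key; rewrite -(fineK (x := \int[mu]_(x in F) _)); last first.
  by rewrite ge0_fin_numE// integral_ge0.
rewrite -EFinD -EFinM !lee_fin LEa.
rewrite (_ : (p * a `^ (p - 1) * (m * a) = p * m * (a `^ (p - 1) * a))%R); last by ring.
by rewrite aE; lra.
Qed.

End lp_finite_measure.

(** * Transfer of oscillation bounds by a nonlocal energy *)

Section nonlocal_poincare.
Context d (T : measurableType d) (R : realType).
Variable mu : {measure set T -> \bar R}.
Variables (p : R) (p1 : 1 <= p).
Variables (Omega : set T) (mOmega : measurable Omega).
Variable (Omega_fin : (mu Omega < +oo)%E).
Variable k : T -> T -> R.
Hypothesis k_ge0 : forall x y, x <> y -> 0 <= k x y.
Variables (kappa : R) (kappa_gt0 : 0 < kappa).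
Local Open Scope ereal_scope.
Implicit Types (F G S : set T) (u : T -> R) (c : (T -> R) -> R).

Definition kernel_energy u : \bar R :=
  \int[mu]_(x in Omega) \int[mu]_(y in Omega) (`|u x - u y| `^ p * k x y)%:E.

Definition deviation S u (a : R) : \bar R :=
  \int[mu]_(x in S) (`|u x - a| `^ p)%:E.

Definition average S u : R := ((fine (mu S))^-1 * \int[mu]_(x in S) u x)%R.

(** For each x in G separately, the kernel is at least kappa at almost every y
    in F; this is all that the iterated integral needs.  The diagonal is left
    out because the kernel is arbitrary there. *)
Definition kernel_link G F := forall x, G x ->
  {ae mu, forall y, F y -> x <> y -> (kappa <= k x y)%R}.

Definition p_integrable u :=
  measurable_fun Omega u /\ \int[mu]_(x in Omega) (`|u x| `^ p)%:E < +oo.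

(** The reference value c u may depend on u, but the constant may not. *)
Definition controlled c S := exists2 C : R, (0 < C)%R &
  forall u, p_integrable u -> deviation S u (c u) <= C%:E * kernel_energy u.

Let p_gt0 : (0 < p)%R. Proof. exact: lt_le_trans p1. Qed.

Lemma kernel_integrand_ge0 u x y : 0 <= (`|u x - u y| `^ p * k x y)%:E.
Proof.
rewrite lee_fin; have [<-|xy] := pselect (x = y).
  by rewrite subrr normr0 powR0 ?mul0r// gt_eqF.
by rewrite mulr_ge0 ?powR_ge0// k_ge0.
Qed.
Local Hint Resolve kernel_integrand_ge0 powR_norm_ge0 : core.

Lemma kernel_energy_ge0 u : 0 <= kernel_energy u.
Proof. by apply: integral_ge0 => x _; apply: integral_ge0. Qed.

Lemma deviation_ge0 S u a : 0 <= deviation S u a.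
Proof. by apply: integral_ge0 => x _; rewrite lee_fin powR_ge0. Qed.

Lemma p_integrableS S u : measurable S -> S `<=` Omega -> p_integrable u ->
  [/\ mu S < +oo, measurable_fun S u &
      \int[mu]_(x in S) (`|u x| `^ p)%:E < +oo].
Proof.
move=> mS SO [mu_ iu]; split.
- by apply: le_lt_trans Omega_fin; apply: le_measure => //; rewrite inE.
- exact: measurable_funS mu_.
- by apply: le_lt_trans iu; apply: ge0_le_lower_integral.
Qed.

Lemma deviation_lty S u a : measurable S -> S `<=` Omega -> p_integrable u ->
  deviation S u a < +oo.
Proof.
move=> mS SO Lu; have [Soo mu_ iu] := p_integrableS mS SO Lu.
exact: lp_subr_cst_lty.
Qed.

Lemma measurable_deviation S u a : measurable_fun S u ->
  measurable_fun S (fun x => (`|u x - a| `^ p)%:E).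
Proof.
move=> mu_; apply: (@measurable_powR_norm _ _ _ _ _ (fun x => u x - a)%R).
exact: measurable_funB.
Qed.

(** The null set where the kernel is small depends on x: the comparison is made
    slice by slice. *)
Lemma kernel_slice G F u x : measurable F -> F `<=` Omega ->
  measurable_fun Omega u -> kernel_link G F -> G x ->
  kappa%:E * \int[mu]_(y in F) (`|u x - u y| `^ p)%:E
    <= \int[mu]_(y in Omega) (`|u x - u y| `^ p * k x y)%:E.
Proof.
move=> mF FO mu_ lGF Gx; have mFu := measurable_funS mOmega FO mu_.
have mf : measurable_fun F (fun y => (`|u x - u y| `^ p)%:E).
  apply: (@measurable_powR_norm _ _ _ _ _ (fun y => u x - u y)%R).
  exact: measurable_funB.
rewrite -ge0_integralZl//; last by rewrite lee_fin ltW.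
apply: ge0_ae_le_lower_integral => //.
- exact: measurable_funeM.
- by move=> y _; rewrite mule_ge0// ?lee_fin ?powR_ge0// ltW.
apply: filterS (lGF x Gx) => y H Fy; rewrite -EFinM lee_fin mulrC.
have [<-|xy] := pselect (x = y).
  by rewrite subrr normr0 powR0 ?mul0r// gt_eqF.
by rewrite ler_wpM2l ?powR_ge0// H.
Qed.

(** At each x in F, Jensen's inequality for y |-> u x - u y bounds
    |u x - average F u|^p by the average of |u x - u y|^p over y in F. *)
Lemma deviation_average_le F u : measurable F -> F `<=` Omega -> 0 < mu F ->
  kernel_link F F -> p_integrable u ->
  deviation F u (average F u) <=
    ((kappa * fine (mu F))^-1)%:E * kernel_energy u.
Proof.
move=> mF FO F0 lFF Lu; have [Foo mFu iFu] := p_integrableS mF FO Lu.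
have m0 : (0 < fine (mu F))%R by rewrite fine_gt0// F0.
have Ffin : mu F \is a fin_num by rewrite ge0_fin_numE.
have pos : (0 < kappa * fine (mu F))%R by rewrite mulr_gt0.
rewrite lee_pdivlMl// /deviation -ge0_integralZl//; last 2 first.
- exact: measurable_deviation.
- by rewrite lee_fin ltW.
apply: ge0_le_lower_integral => // [x Fx|x _|x Fx].
- by rewrite mule_ge0// lee_fin ?powR_ge0// ltW.
- exact: integral_ge0.
apply: le_trans (kernel_slice mF FO (proj1 Lu) lFF Fx).
rewrite EFinM -muleA lee_pmul2l// fineK//.
have mw : measurable_fun F (fun y => u x - u y)%R by exact: measurable_funB.
have iw : \int[mu]_(y in F) (`|u x - u y| `^ p)%:E < +oo.
  under eq_integral do rewrite distrC.
  exact: lp_subr_cst_lty.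
have := jensen_powR p1 mF Foo mw iw.
rewrite RintegralB//; last 2 first.
- exact: integrable_cst_lty.
- exact: (lp_integrable p1 mF Foo mFu).
rewrite Rintegral_cst// mulrBr mulrCA mulVf ?mulr1//.
by rewrite gt_eqF.
Qed.

(** Start of the chain step: |u x - a|^p is averaged over an auxiliary point y
    of F.  The resulting bound on G involves the inner integral of the energy,
    which may fail to be measurable in x, so lower integrals cannot be added.
    The measurable term is therefore moved to the other side, and the positive
    part of the difference is what is compared with the inner integral. *)
Lemma deviation_transfer G F : measurable G -> G `<=` Omega ->
  measurable F -> F `<=` Omega -> 0 < mu F -> kernel_link G F ->
  exists2 C : R, (0 < C)%R & forall u a, p_integrable u ->
    deviation G u a <= C%:E * (deviation F u a + kernel_energy u).
Proof.
move=> mG GO mF FO F0 lGF.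
have Goo : mu G < +oo.
  by apply: le_lt_trans Omega_fin; apply: le_measure => //; rewrite inE.
have Foo : mu F < +oo.
  by apply: le_lt_trans Omega_fin; apply: le_measure => //; rewrite inE.
set m := fine (mu F).
have m0 : (0 < m)%R by rewrite fine_gt0// F0.
have Ffin : mu F \is a fin_num by rewrite ge0_fin_numE.
have Gfin : mu G \is a fin_num by rewrite ge0_fin_numE.
have q0 : (0 < 2 `^ p :> R)%R by rewrite powR_gt0.
set q := (2 `^ p)%R in q0.
have g0 : (0 <= fine (mu G))%R by rewrite fine_ge0.
exists (q / m * (kappa^-1 + fine (mu G)))%R.
  by rewrite mulr_gt0 ?divr_gt0// ltr_pwDl// invr_gt0.
move=> u a Lu; have [_ mGu _] := p_integrableS mG GO Lu.
have [_ mFu _] := p_integrableS mF FO Lu.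
have Koo := deviation_lty a mF FO Lu.
set K := fine (deviation F u a).
have KE : deviation F u a = K%:E.
  by rewrite fineK// ge0_fin_numE// deviation_ge0.
have K0 : (0 <= K)%R by rewrite fine_ge0// deviation_ge0.
have pointwise x : G x -> (m * `|u x - a| `^ p)%:E <=
    q%:E * (\int[mu]_(y in F) (`|u x - u y| `^ p)%:E + K%:E).
  move=> Gx.
  have mf : measurable_fun F (fun y => (`|u x - u y| `^ p)%:E).
    apply: (@measurable_powR_norm _ _ _ _ _ (fun y => u x - u y)%R).
    exact: measurable_funB.
  have mg := measurable_deviation a mFu.
  rewrite -KE -ge0_integralD// -ge0_integralZl//; last 3 first.
  - exact: emeasurable_funD.
  - by move=> y _; rewrite adde_ge0.
  - by rewrite lee_fin ltW.
  rewrite mulrC EFinM fineK// -(integral_cst mu mF).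
  apply: ge0_le_integral => //.
  - by move=> y _; rewrite /= lee_fin powR_ge0.
  - by apply: measurable_funeM; exact: emeasurable_funD.
  move=> y _; rewrite -EFinD -EFinM lee_fin.
  by rewrite (le_trans _ (powRD_le _ _ p1))// subrKA.
(* What remains of m |u x - a|^p beyond the part bounded by K, scaled so that
   the inner integral of the energy dominates it. *)
pose h x := (kappa / q * Num.max 0 (m * `|u x - a| `^ p - q * K))%R.
have h0 x : (0 <= h x)%R.
  by rewrite mulr_ge0// ?divr_ge0 ?le_max ?lexx// ltW.
have mdev : measurable_fun G (fun x => `|u x - a| `^ p)%R.
  exact/measurable_EFinP/measurable_deviation.
have mh : measurable_fun G (EFin \o h).
  apply/measurable_EFinP; apply: measurable_funM => //.
  apply: measurable_maxr => //; apply: measurable_funB => //.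
  exact: measurable_funM.
have hE : \int[mu]_(x in G) (h x)%:E <= kernel_energy u.
  apply: ge0_le_lower_integral => // [x _|x _|x Gx].
  - by rewrite lee_fin.
  - exact: integral_ge0.
  apply: le_trans (kernel_slice mF FO (proj1 Lu) lGF Gx).
  have := pointwise x Gx.
  have : 0 <= \int[mu]_(y in F) (`|u x - u y| `^ p)%:E by exact: integral_ge0.
  case: (integral _ _ _) => [r| |] //; last first.
    by move=> _ _; rewrite gt0_muley ?lte_fin// leey.
  rewrite -EFinD -!EFinM !lee_fin => r0 Hr.
  rewrite /h -mulrA ler_pM2l// ler_pdivrMl// ge_max mulr_ge0 ?(ltW q0)//=.
  by rewrite lerBlDr -mulrDr.
have : m%:E * deviation G u a <=
    (q / kappa)%:E * kernel_energy u + (q * K)%:E * mu G.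
  apply: (@le_trans _ _ (\int[mu]_(x in G)
      ((q / kappa)%:E * (h x)%:E + cst (q * K)%:E x))).
    rewrite /deviation -ge0_integralZl//; last 2 first.
    - exact: measurable_deviation.
    - by rewrite lee_fin ltW.
    apply: ge0_le_integral => //.
    - by move=> x _; rewrite mule_ge0 ?lee_fin ?powR_ge0// ltW.
    - by apply: measurable_funeM; exact: measurable_deviation.
    - by apply: emeasurable_funD => //; apply: measurable_funeM.
    move=> x _; rewrite /= -!EFinM -EFinD lee_fin /h.
    have -> : (q / kappa * (kappa / q * Num.max 0 (m * `|u x - a| `^ p - q * K)) =
       Num.max 0 (m * `|u x - a| `^ p - q * K))%R.
      by field; rewrite !gt_eqF.
    by rewrite -lerBlDr le_max lexx orbT.
  rewrite ge0_integralD//; last 3 first.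
  - by move=> x _; rewrite mule_ge0// lee_fin// divr_ge0// ltW.
  - exact: measurable_funeM.
  - by move=> x _; rewrite lee_fin mulr_ge0// ltW.
  rewrite integral_cst// ge0_integralZl//; last 2 first.
  - by move=> x _; rewrite lee_fin.
  - by rewrite lee_fin divr_ge0// ltW.
  by rewrite leeD2r// lee_wpmul2l// lee_fin divr_ge0// ltW.
rewrite -lee_pdivlMl// => /le_trans; apply.
rewrite lee_pdivrMl// KE -[X in _ + _ * X](fineK Gfin).
have := kernel_energy_ge0 u.
case: (kernel_energy u) => [e| |] //; last first.
  move=> _; rewrite (addey (x := K%:E))// (@gt0_muley _ (_ * (_ + _))%:E); last first.
    by rewrite lte_fin mulr_gt0 ?divr_gt0// ltr_pwDl// invr_gt0.
  by rewrite (@gt0_muley _ m%:E) ?leey ?lte_fin.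
rewrite lee_fin => e0; rewrite -(EFinD K) -!EFinM -EFinD lee_fin.
have -> : (m * (q / m * (kappa^-1 + fine (mu G)) * (K + e)) =
   q * (kappa^-1 + fine (mu G)) * (K + e))%R.
  by field; rewrite !gt_eqF.
rewrite -!mulrA -mulrDr ler_wpM2l ?(ltW q0)//.
have : (0 <= kappa^-1 * K + fine (mu G) * e)%R.
  by rewrite addr_ge0// mulr_ge0// invr_ge0 ltW.
by nra.
Qed.

Lemma controlled_average F : measurable F -> F `<=` Omega -> 0 < mu F ->
  kernel_link F F -> controlled (average F) F.
Proof.
move=> mF FO F0 lFF; have Foo : mu F < +oo.
  by apply: le_lt_trans Omega_fin; apply: le_measure => //; rewrite inE.
exists ((kappa * fine (mu F))^-1)%R; last by move=> u; exact: deviation_average_le.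
by rewrite invr_gt0 mulr_gt0// fine_gt0// F0.
Qed.

(** The step of the chain argument: the bound on F passes to G. *)
Lemma controlled_link c G F : measurable G -> G `<=` Omega ->
  measurable F -> F `<=` Omega -> 0 < mu F -> kernel_link G F ->
  controlled c F -> controlled c G.
Proof.
move=> mG GO mF FO F0 lGF [C C0 HC].
have [C' C'0 HC'] := deviation_transfer mG GO mF FO F0 lGF.
exists (C' * (C + 1))%R; first by rewrite mulr_gt0// addr_gt0.
move=> u Lu; apply: (le_trans (HC' u _ Lu)).
rewrite EFinM -muleA lee_wpmul2l ?lee_fin ?(ltW C'0)//.
rewrite EFinD ge0_muleDl ?lee_fin ?(ltW C0)// mul1e.
by rewrite leeD2r// HC.
Qed.

Lemma controlled0 c : controlled c set0.
Proof.
exists 1%R => // u _; rewrite /deviation integral_set0 mul1e.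
exact: kernel_energy_ge0.
Qed.

Lemma controlledU c F G : measurable F -> measurable G ->
  F `<=` Omega -> G `<=` Omega ->
  controlled c F -> controlled c G -> controlled c (F `|` G).
Proof.
move=> mF mG FO GO [C C0 HC] [D D0 HD].
exists (C + D)%R => [|u Lu]; first by rewrite addr_gt0.
have [_ mFu _] := p_integrableS mF FO Lu.
have mGFO : G `\` F `<=` Omega by move=> x [/GO].
have mGF : measurable (G `\` F) by exact: measurableD.
have [_ mGFu _] := p_integrableS mGF mGFO Lu.
rewrite EFinD ge0_muleDl ?lee_fin ?(ltW C0) ?(ltW D0)//.
apply: (le_trans _ (leeD (HC u Lu) (HD u Lu))).
have -> : F `|` G = F `|` (G `\` F) by rewrite setUDr setDv setD0.
rewrite /deviation ge0_integral_setU//; last 2 first.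
- apply/measurable_funU => //.
  by split; exact: measurable_deviation.
- by apply/disj_setPRL => x [].
by rewrite leeD2l// ge0_le_lower_integral.
Qed.

Lemma controlledS c F G : G `<=` F -> controlled c F -> controlled c G.
Proof.
move=> GF [C C0 HC]; exists C => // u Lu; apply: (le_trans _ (HC u Lu)).
by apply: ge0_le_lower_integral => // x _; rewrite lee_fin powR_ge0.
Qed.

(** By Jensen's inequality, |average Omega u - c u|^p is at most the mean of
    |u - c u|^p on Omega, so the average may replace c u at the price of a
    constant factor. *)
Lemma controlled_average_Omega c :
  controlled c Omega -> controlled (average Omega) Omega.
Proof.
move=> [C C0 HC]; have q0 : (0 < 2 `^ p :> R)%R by rewrite powR_gt0.
exists (2 `^ p * (C + C))%R => [|u Lu]; first by rewrite mulr_gt0// addr_gt0.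
have [_ mOu iOu] := p_integrableS mOmega (@subset_refl _ Omega) Lu.
have mdev := measurable_deviation (c u) mOu.
set a := average Omega u.
have H : mu Omega * (`|c u - a| `^ p)%:E <= deviation Omega u (c u).
  have mw : measurable_fun Omega (fun y => u y - c u)%R by exact: measurable_funB.
  have := jensen_powR p1 mOmega Omega_fin mw (deviation_lty (c u) mOmega (@subset_refl _ Omega) Lu).
  have [->|O0] := eqVneq (mu Omega) 0; first by rewrite !mul0e.
  have m0 : (0 < fine (mu Omega))%R by rewrite fine_gt0// Omega_fin lt0e O0 measure_ge0.
  rewrite RintegralB//; last 2 first.
  - exact: (lp_integrable p1 mOmega Omega_fin mOu).
  - exact: integrable_cst_lty.
  rewrite Rintegral_cst// mulrBr mulrCA mulVf ?mulr1 ?gt_eqF//.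
  by rewrite distrC.
apply: (@le_trans _ _ ((2 `^ p)%:E * (deviation Omega u (c u) +
    (`|c u - a| `^ p)%:E * mu Omega))).
  rewrite -(integral_cst mu mOmega) -ge0_integralD//; last first.
    by move=> x _; rewrite lee_fin powR_ge0.
  rewrite -ge0_integralZl//; last 2 first.
  - exact: emeasurable_funD.
  - by move=> y _; rewrite adde_ge0// lee_fin powR_ge0.
  apply: ge0_le_integral => //.
  - exact: measurable_deviation.
  - by apply: measurable_funeM; exact: emeasurable_funD.
  move=> y _; rewrite -EFinD -EFinM lee_fin.
  by rewrite (le_trans _ (powRD_le _ _ p1))// subrKA.
rewrite EFinM -muleA lee_wpmul2l ?lee_fin ?(ltW q0)//.
rewrite EFinD ge0_muleDl ?lee_fin ?(ltW C0)//.
by rewrite leeD// ?HC// muleC (le_trans H)// HC.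
Qed.

End nonlocal_poincare.

(** * The volume of boxes *)

Section box_covering.
Context (R : realType).
Local Open Scope ereal_scope.

Lemma lebesgue_measure_oo (l h : R) :
  lebesgue_measure `]l, h[%classic = (Num.max 0 (h - l))%:E.
Proof.
rewrite lebesgue_measure_itv/= lte_fin; case: ltP => lh.
  by rewrite -EFinB max_r// subr_ge0 ltW.
by rewrite max_l// subr_le0.
Qed.

(** Integrate the hypothesis in y for the Lebesgue measure of the line. *)
Lemma interval_cover (a l h : R) (b lk hk : nat -> R) :
  (0 <= a)%R -> (forall k, 0 <= b k)%R ->
  (forall y, (l < y < h)%R ->
    a%:E <= \sum_(k <oo) (b k * (lk k < y < hk k)%R%:R)%:E) ->
  (a * Num.max 0 (h - l))%:E
    <= \sum_(k <oo) (b k * Num.max 0 (hk k - lk k))%:E.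
Proof.
move=> a0 b0 cov; pose mu := @lebesgue_measure R.
have intE c u v : (0 <= c)%R ->
    \int[mu]_y (c%:E * (\1_(`]u, v[%classic : set R) y)%:E) =
    (c * Num.max 0 (v - u))%:E.
  move=> c0; rewrite ge0_integralZl//.
  - by rewrite integral_indic// setIT EFinM; congr (_ * _); exact: lebesgue_measure_oo.
  - by apply/measurable_EFinP; exact: measurable_indic.
rewrite -intE//; under eq_eseriesr do rewrite -intE//.
have m_ (c u v : R) : measurable_fun [set: measurableTypeR R]
    (fun y => c%:E * (\1_(`]u, v[%classic : set R) y)%:E).
  by apply: measurable_funeM; apply/measurable_EFinP; exact: measurable_indic.
have ge0 (c u v y : R) : (0 <= c)%R ->
    0 <= c%:E * (\1_(`]u, v[%classic : set R) y)%:E.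
  by move=> c0; rewrite mule_ge0// lee_fin.
rewrite -integral_nneseries//; last by move=> k y _; exact: ge0.
apply: ge0_le_integral => //.
- by move=> y _; exact: ge0.
- apply: ge0_emeasurable_sum => [k y _ _|k _]; [exact: ge0|exact: m_].
move=> y _; rewrite indicE.
under eq_eseriesr do rewrite indicE -EFinM mem_setE in_itv/=.
rewrite -EFinM mem_setE in_itv/=; case: (boolP (l < y < h)%R) => [lyh|_].
  by rewrite mulr1; exact: cov.
by rewrite mulr0 nneseries_ge0// => k _ _; rewrite lee_fin mulr_ge0.
Qed.

(** By induction on the dimension, one coordinate is integrated out at a time:
    with the other coordinates fixed, [interval_cover] turns the weights a and
    b k into a and b k times the lengths of the last sides.  Carrying the
    weights makes the induction go through, and sums over a countable cover are
    exchanged with the integral by monotone convergence. *)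
Lemma product_cover n (a : R) (l h : nat -> R) (b : nat -> R)
    (lk hk : nat -> nat -> R) :
  (0 <= a)%R -> (forall k, 0 <= b k)%R ->
  (forall x : nat -> R, (forall i, (i < n)%N -> (l i < x i < h i)%R) ->
    a%:E <= \sum_(k <oo)
      (b k * [forall i : 'I_n, (lk k i < x i < hk k i)%R]%:R)%:E) ->
  (a * \prod_(i < n) Num.max 0 (h i - l i))%:E
    <= \sum_(k <oo) (b k * \prod_(i < n) Num.max 0 (hk k i - lk k i))%:E.
Proof.
elim: n a b => [|n IH] a b a0 b0 cov.
  rewrite big_ord0 mulr1; apply: le_trans (cov (fun=> 0%R) _) _ => //.
  apply: lee_nneseries => k *; first by rewrite lee_fin mulr_ge0.
  by rewrite big_ord0 lee_fin ler_wpM2l// lern1 leq_b1.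
have max0 (u v : R) : (0 <= Num.max 0 (u - v))%R by rewrite le_max lexx.
rewrite big_ord_recr/= [X in (_ * X)%R]mulrC mulrA.
under eq_eseriesr do rewrite big_ord_recr/= [X in (_ * X)%R]mulrC mulrA.
apply: IH => [|k|x xlh]; [exact: mulr_ge0|exact: mulr_ge0|].
under eq_eseriesr do rewrite mulrAC.
apply: interval_cover => // [k|y ylh]; first by rewrite mulr_ge0.
pose z i := if i == n then y else x i.
have /cov/le_trans : forall i, (i < n.+1)%N -> (l i < z i < h i)%R.
  move=> i; rewrite ltnS leq_eqVlt /z => /predU1P[->|iltn]; first by rewrite eqxx.
  by rewrite (ltn_eqF iltn) xlh.
apply; apply: lee_nneseries => k *; first by rewrite lee_fin mulr_ge0.
rewrite lee_fin -mulrA ler_wpM2l//.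
case: (boolP [forall i : 'I_n.+1, _]) => [/forallP H|_]; last by rewrite mulr_ge0.
have := H ord_max; rewrite /z/= eqxx => ->; rewrite mulr1.
rewrite (_ : [forall i, _] = true)//; apply/forallP => i.
by have := H (widen_ord (leqnSn n) i); rewrite /z/= (ltn_eqF (ltn_ord i)).
Qed.

End box_covering.

(** * Lebesgue measure on row vectors *)

Section lebesgue_on_row_vectors.
Context (R : realType) (d : nat).
Local Notation V := 'rV[R]_d.+1.
Local Notation leb := (@lebesgue R d).
Local Notation outer := (@lebesgue_outer R d).
Local Open Scope ereal_scope.
Implicit Types (c : V * V) (x y : V) (A N U : set V) (i : 'I_d.+1) (t e : R).

Lemma box_volume_cover c (B : nat -> V * V) :
  box c `<=` \bigcup_k box (B k) ->
  box_volume c <= \sum_(k <oo) box_volume (B k).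
Proof.
move=> cB.
pose l n := c.1 ord0 (inord n); pose h n := c.2 ord0 (inord n).
pose lk k n := (B k).1 ord0 (inord n); pose hk k n := (B k).2 ord0 (inord n).
have := @product_cover R d.+1 1%R l h (fun=> 1%R) lk hk.
rewrite mul1r /box_volume; under eq_bigr do rewrite /l /h inord_val.
under eq_eseriesr => k _ do
  (rewrite mul1r; under eq_bigr do rewrite /lk /hk inord_val).
apply => // x xlh.
have : box c (\row_i x i).
  by move=> i; rewrite mxE; have := xlh i (ltn_ord i); rewrite /l /h inord_val.
move=> /cB[k _ Bkx]; rewrite (@nneseriesD1 R _ k)//.
  rewrite -[leLHS]adde0 leeD//; last exact: nneseries_ge0.
  rewrite lee_fin mul1r (_ : [forall i, _] = true)//; apply/forallP => i.
  by have := Bkx i; rewrite mxE /lk /hk inord_val.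
Qed.

Lemma box_volume_le_outer c : box_volume c <= outer (box c).
Proof. by apply: le_ereal_inf_tmp => _ [B cB <-]; exact: box_volume_cover. Qed.

Lemma outer_box_le c : outer (box c) <= box_volume c.
Proof.
pose B k := if k is 0%N then c else (0%R, 0%R) : V * V.
apply: ge_ereal_inf; exists (\sum_(k <oo) box_volume (B k)).
  by exists B => // x cx; exists 0%N.
rewrite (@nneseriesD1 R _ 0%N)//=; last by move=> k _; exact: box_volume_ge0.
rewrite eseries0 ?adde0// => -[//|k] _ _ /=.
by rewrite /box_volume /= big_ord_recl subrr maxxx mul0r.
Qed.

Lemma outer_null_measurable A : outer A = 0 -> measurable A.
Proof.
move=> A0; apply: le_caratheodory_measurable => X.
rewrite [X in X + _](_ : _ = 0).
  by rewrite add0e; apply: le_lebesgue_outer => x [].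
apply/eqP; rewrite eq_le lebesgue_outer_ge0 andbT -A0.
by apply: le_lebesgue_outer => x [].
Qed.

Definition set_coord x i t : V := \row_j (if j == i then t else x ord0 j).

(** The part of the hyperplane with coordinates bounded by n is covered by one
    box of arbitrarily small width in the direction i. *)
Lemma hyperplane_null i t : outer [set x | x ord0 i = t] = 0.
Proof.
pose H := [set x : V | x ord0 i = t].
pose K n := [set x : V | x ord0 i = t /\ forall j, (- n%:R < x ord0 j < n%:R)%R].
have K0 n : outer (K n) = 0.
  apply/eqP; rewrite eq_le lebesgue_outer_ge0 andbT.
  pose M := (\prod_(j < d.+1 | j != i) Num.max 0 (n%:R - - n%:R) : R)%R.
  have M0 : (0 <= M)%R by apply: prodr_ge0 => j _; rewrite le_max lexx.
  apply/lee_addgt0Pr => e e0; rewrite add0e.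
  (* The covering box has volume 2 s M, and M may vanish. *)
  pose s := (e / (M + 1) / 2)%R.
  have s0 : (0 < s)%R by rewrite !divr_gt0// ltr_wpDl.
  pose c : V * V := (set_coord (const_mx (- n%:R)) i (t - s),
                     set_coord (const_mx n%:R) i (t + s))%R.
  have Kc : K n `<=` box c.
    move=> x [xi xn] j; rewrite !mxE; case: eqVneq => [->|_]; last exact: xn.
    by rewrite xi; apply/andP; split; lra.
  apply: (le_trans (le_lebesgue_outer Kc)); apply: (le_trans (outer_box_le c)).
  rewrite /box_volume lee_fin (bigD1 i)//= !mxE eqxx.
  under eq_bigr => j ji do rewrite !mxE (negbTE ji).
  rewrite -/M (_ : t + s - (t - s) = e / (M + 1))%R; last first.
    by rewrite /s; field; rewrite gt_eqF// ltr_wpDl.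
  rewrite max_r ?divr_ge0 ?addr_ge0 ?(ltW e0)//.
  rewrite -mulrA ler_piMr ?(ltW e0)// mulrC ler_pdivrMr ?mul1r ?ltr_wpDl//.
  by rewrite lerDl.
apply/eqP; rewrite eq_le lebesgue_outer_ge0 andbT.
have HK : H `<=` \bigcup_n K n.
  move=> x xi; pose m := (\sum_j `|x ord0 j|)%R.
  exists (Num.bound m) => //; split => // j; rewrite -ltr_norml.
  have m0 : (0 <= m)%R by exact: sumr_ge0.
  apply: le_lt_trans (archi_boundP m0).
  by rewrite /m (bigD1 j)//= lerDl sumr_ge0.
apply: (le_trans (le_lebesgue_outer HK)).
apply: (le_trans (@lebesgue_outer_sigma_subadditive R d K)).
by rewrite eseries0.
Qed.

(** Caratheodory's criterion: the half-space cuts each box of a cover of X into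
    two boxes, which cover both parts of X up to the null hyperplane. *)
Lemma halfspace_measurable i t : measurable [set x : V | (x ord0 i < t)%R].
Proof.
apply: le_caratheodory_measurable => X.
apply: le_ereal_inf_tmp => _ [B XB <-].
pose Bl k : V * V := ((B k).1, set_coord (B k).2 i (Num.min ((B k).2 ord0 i) t)).
pose Br k : V * V := (set_coord (B k).1 i (Num.max ((B k).1 ord0 i) t), (B k).2).
(* Cutting a box by the hyperplane does not increase the total volume. *)
have volD k : box_volume (Bl k) + box_volume (Br k) <= box_volume (B k).
  rewrite /box_volume -EFinD lee_fin.
  pose P := (\prod_(j | j != i) Num.max 0 ((B k).2 ord0 j - (B k).1 ord0 j) : R)%R.
  have P0 : (0 <= P)%R by apply: prodr_ge0 => j _; rewrite le_max lexx.
  rewrite [X in (X + _ <= _)%R](_ : _ =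
      Num.max 0 (Num.min ((B k).2 ord0 i) t - (B k).1 ord0 i) * P)%R; last first.
    rewrite (bigD1 i)//= mxE eqxx; congr (_ * _)%R.
    by apply: eq_bigr => j ji; rewrite mxE (negbTE ji).
  rewrite [X in (_ + X <= _)%R](_ : _ =
      Num.max 0 ((B k).2 ord0 i - Num.max ((B k).1 ord0 i) t) * P)%R; last first.
    rewrite (bigD1 i)//= mxE eqxx; congr (_ * _)%R.
    by apply: eq_bigr => j ji; rewrite mxE (negbTE ji).
  rewrite [leRHS](bigD1 i)//= -/P -mulrDl ler_wpM2r//.
  move: ((B k).1 ord0 i) ((B k).2 ord0 i) => u v.
  have [vt|tv] := leP v t.
    by rewrite [X in (_ + X)%R]max_l ?addr0// subr_le0 le_max vt orbT.
  have [ut|tu] := leP u t; last by rewrite max_l ?add0r// subr_le0 ltW.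
  rewrite !max_r ?subr_ge0 ?(ltW tv)//; last exact: le_trans ut (ltW tv).
  by rewrite addrC subrKA.
rewrite (le_trans _ (lee_nneseries _ (fun k _ => volD k)))//; last first.
  by move=> k _ _; rewrite adde_ge0// box_volume_ge0.
rewrite nneseriesD; [|by move=> *; exact: box_volume_ge0..].
apply: leeD.
  apply: ereal_inf_lbound; exists Bl => // x [/XB[k _ Bkx] xt].
  exists k => // j; have := Bkx j; rewrite !mxE; case: eqVneq => [->|//].
  by rewrite lt_min xt andbT.
have split_X : X `&` ~` [set x : V | (x ord0 i < t)%R] `<=`
    [set x : V | x ord0 i = t] `|` (X `&` [set x : V | (t < x ord0 i)%R]).
  move=> x [Xx /negP]; rewrite -leNgt le_eqVlt.
  by move=> /predU1P[->|tx]; [left|right].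
apply: (le_trans (le_lebesgue_outer split_X)).
apply: (le_trans (outer_measureU2 _ _ _)).
rewrite [X in X + _]hyperplane_null add0e.
apply: ereal_inf_lbound; exists Br => // x [/XB[k _ Bkx] xt].
exists k => // j; have := Bkx j; rewrite !mxE; case: eqVneq => [->|//].
by rewrite gt_max xt andbT.
Qed.

(** The complement of the opposite half-space, up to the null hyperplane. *)
Lemma halfspaceN_measurable i t : measurable [set x : V | (t < x ord0 i)%R].
Proof.
have -> : [set x : V | (t < x ord0 i)%R] =
    ~` ([set x : V | x ord0 i = t] `|` [set x : V | (x ord0 i < t)%R]).
  apply/seteqP; split => x /=.
    by move=> tx [xt|]; [rewrite xt ltxx in tx|rewrite ltNge ltW].
  move=> /not_orP[/eqP xt /negP]; rewrite -leNgt => tx.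
  by rewrite lt_neqAle eq_sym xt.
apply: measurableC; apply: measurableU; last exact: halfspace_measurable.
exact/outer_null_measurable/hyperplane_null.
Qed.

Lemma box_measurable c : measurable (box c).
Proof.
have -> : box c = \bigcap_(i in [set: 'I_d.+1])
    ([set x : V | (c.1 ord0 i < x ord0 i)%R] `&`
     [set x : V | (x ord0 i < c.2 ord0 i)%R]).
  apply/seteqP; split => [x cx i _|x cx i].
    by have /andP := cx i.
  by have [/= -> ->] := cx i I.
apply: fin_bigcap_measurable => // i _; apply: measurableI.
- exact: halfspaceN_measurable.
- exact: halfspace_measurable.
Qed.

Lemma open_rational_box U x : open U -> U x ->
  exists q : 'rV[rat]_d.+1 * 'rV[rat]_d.+1,
    let c := (map_mx ratr q.1, map_mx ratr q.2) in box c x /\ box c `<=` U.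
Proof.
rewrite openE => /[apply] /nbhs_ballP[e /= e0 eU].
have below (i : 'I_d.+1) : exists q : rat, (x ord0 i - e < ratr q < x ord0 i)%R.
  have /rat_in_itvoo[q] : (x ord0 i - e < x ord0 i)%R by rewrite ltrBlDr ltrDl.
  by rewrite in_itv; exists q.
have above (i : 'I_d.+1) : exists q : rat, (x ord0 i < ratr q < x ord0 i + e)%R.
  have /rat_in_itvoo[q] : (x ord0 i < x ord0 i + e)%R by rewrite ltrDl.
  by rewrite in_itv; exists q.
have [l lP] := choice below; have [h hP] := choice above.
exists (\row_i l i, \row_i h i) => /=; split => [i|y cy].
  by rewrite !mxE; have /andP[_ ->] := lP i; have /andP[-> _] := hP i.
apply: eU; split => // i j; rewrite ord1 /ball/= ltr_distlC.
have := cy j; rewrite !mxE; have /andP[+ _] := lP j; have /andP[_ +] := hP j.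
by move=> ? ? /andP[? ?]; apply/andP; split; lra.
Qed.

Lemma open_lebesgue_measurable U : open U -> measurable U.
Proof.
move=> oU; pose c (q : 'rV[rat]_d.+1 * 'rV[rat]_d.+1) : V * V :=
  (map_mx ratr q.1, map_mx ratr q.2).
have -> : U = \bigcup_q [set x | box (c q) x /\ box (c q) `<=` U].
  apply/seteqP; split => [x Ux|x [q _ [cx]]]; last exact.
  by have [q qP] := open_rational_box oU Ux; exists q.
apply: countable_bigcupT_measurable => // q.
have [cU|cU] := pselect (box (c q) `<=` U).
  rewrite (_ : [set _ | _] = box (c q)); first exact: box_measurable.
  by apply/seteqP; split => x /= => [[]|].
by rewrite (_ : [set _ | _] = set0)// -subset0 => x /= [].
Qed.

Lemma lebesgue_open_gt0 U : open U -> U !=set0 -> 0 < leb U.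
Proof.
move=> oU [x Ux]; have [q /= [cx cU]] := open_rational_box oU Ux.
apply: (lt_le_trans _ (le_lebesgue_outer cU)).
apply: (lt_le_trans _ (box_volume_le_outer _)).
rewrite /box_volume lte_fin; apply: prodr_gt0 => i _.
by rewrite lt_max subr_gt0 orbC; have /andP[] := cx i; move=> /lt_trans/[apply] ->.
Qed.

Lemma lebesgue_bounded_lty A : ebounded A -> leb A < +oo.
Proof.
move=> [M AM]; pose c : V * V := (const_mx (- (M + 1)), const_mx (M + 1))%R.
have Ac : A `<=` box c.
  move=> x /AM xM i; rewrite !mxE -ltr_norml; apply: (@le_lt_trans _ _ M); last first.
    by rewrite ltrDl.
  apply: le_trans xM; rewrite /enorm -sqrtr_sqr ler_wsqrtr//.
  by rewrite (bigD1 i)//= lerDl sumr_ge0// => j _; exact: sqr_ge0.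
apply: (le_lt_trans (le_lebesgue_outer Ac)); apply: (le_lt_trans (outer_box_le c)).
exact: ltry.
Qed.

Lemma outer_reflect_null x N : outer N = 0 -> outer [set y | N (x - y)%R] = 0.
Proof.
move=> N0; apply/eqP; rewrite eq_le lebesgue_outer_ge0 andbT -N0.
apply: le_ereal_inf_tmp => _ [B NB <-].
apply: ereal_inf_lbound; exists (fun k => (x - (B k).2, x - (B k).1)%R).
  move=> y /= /NB[k _ Bk]; exists k => // i /=; have /andP[] := Bk i.
  by rewrite !mxE => ? ?; apply/andP; split; lra.
apply: eq_eseriesr => k _; rewrite /box_volume; congr (_%:E).
by apply: eq_bigr => i _; rewrite /= !mxE; congr (Num.max 0 _)%R; ring.
Qed.

Lemma ae_reflect (P : V -> Prop) x :
  {ae leb, forall h, P h} -> {ae leb, forall y, P (x - y)%R}.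
Proof.
move=> [N [mN N0 PN]]; exists [set y | N (x - y)%R]; split.
- exact/outer_null_measurable/outer_reflect_null.
- exact: outer_reflect_null.
- by move=> y /= Py; apply: PN.
Qed.

End lebesgue_on_row_vectors.

(** * Euclidean distance, connectedness and compactness *)

Section euclidean_geometry.
Context (R : realType) (d : nat).
Local Notation V := 'rV[R]_d.+1.
Implicit Types (x y z : V) (U W : set V).

Lemma enorm_ge0 x : 0 <= enorm x.
Proof. exact: sqrtr_ge0. Qed.

Lemma enormN x : enorm (- x) = enorm x.
Proof. by congr Num.sqrt; apply: eq_bigr => i _; rewrite mxE sqrrN. Qed.

Lemma enormZ (a : R) x : enorm (a *: x) = `|a| * enorm x.
Proof.
rewrite /enorm -sqrtr_sqr -sqrtrM ?sqr_ge0// mulr_sumr.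
by congr Num.sqrt; apply: eq_bigr => i _; rewrite mxE exprMn.
Qed.

(** The sum of the squares of B x_i - C y_i is B (A B - C^2), where A and B are
    the sums of squares and C is the scalar product. *)
Lemma cauchy_schwarz_sum x y :
  (\sum_i x ord0 i * y ord0 i) ^+ 2 <=
  (\sum_i x ord0 i ^+ 2) * (\sum_i y ord0 i ^+ 2).
Proof.
set A := \sum_i x ord0 i ^+ 2; set B := \sum_i y ord0 i ^+ 2.
set C := \sum_i _.
have B0 : 0 <= B by apply: sumr_ge0 => i _; exact: sqr_ge0.
have sq : \sum_i (B * x ord0 i - C * y ord0 i) ^+ 2 = B * (A * B - C ^+ 2).
  rewrite (eq_bigr (fun i => B ^+ 2 * x ord0 i ^+ 2 -
      2 * B * C * (x ord0 i * y ord0 i) + C ^+ 2 * y ord0 i ^+ 2)); last first.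
    by move=> i _; ring.
  by rewrite big_split sumrB/= -!mulr_sumr -/A -/B -/C; ring.
have [B00|Bn0] := eqVneq B 0.
  rewrite /C big1 ?expr0n ?B00 ?mulr0// => i _.
  have /eqP := B00; rewrite psumr_eq0 => [/allP|j _]; last exact: sqr_ge0.
  move=> /(_ i (mem_index_enum i)); rewrite sqrf_eq0 => /eqP ->.
  by rewrite mulr0.
have Bp : 0 < B by rewrite lt0r Bn0.
rewrite -subr_ge0 -(pmulr_rge0 _ Bp) -sq.
by apply: sumr_ge0 => i _; exact: sqr_ge0.
Qed.

Lemma enormD x y : enorm (x + y) <= enorm x + enorm y.
Proof.
have sq z : enorm z ^+ 2 = \sum_i z ord0 i ^+ 2.
  by rewrite sqr_sqrtr// sumr_ge0// => i _; exact: sqr_ge0.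
rewrite -(ler_pXn2r (n := 2))// ?nnegrE ?addr_ge0 ?enorm_ge0//.
rewrite sqrrD !sq.
rewrite (eq_bigr (fun i => x ord0 i ^+ 2 + 2 * (x ord0 i * y ord0 i) +
  y ord0 i ^+ 2)); last by move=> i _; rewrite mxE sqrrD mulr_natl.
rewrite !big_split/= lerD2r lerD2l -mulr_sumr -[leRHS]mulr_natl ler_pM2l//.
apply: le_trans (ler_norm _) _.
rewrite -(ler_pXn2r (n := 2))// ?nnegrE ?mulr_ge0 ?enorm_ge0//.
by rewrite exprMn !sq real_normK ?num_real// cauchy_schwarz_sum.
Qed.

Lemma enorm_distC x y : enorm (x - y) = enorm (y - x).
Proof. by rewrite -enormN opprB. Qed.

Lemma enorm_distD x y z : enorm (x - z) <= enorm (x - y) + enorm (y - z).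
Proof. by apply: le_trans (enormD _ _); rewrite subrKA. Qed.

Lemma enorm_le_sum x : enorm x <= \sum_i `|x ord0 i|.
Proof.
have s0 : 0 <= \sum_i `|x ord0 i| by exact: sumr_ge0.
rewrite -(ger0_norm s0) -sqrtr_sqr ler_wsqrtr// expr2 mulr_suml.
apply: ler_sum => i _; rewrite -real_normK ?num_real// expr2 ler_wpM2l//.
by rewrite (bigD1 i)//= lerDl sumr_ge0.
Qed.

(** Balls are cubes, being those of the sup norm; the factor d+1 comes from the comparison of
    the Euclidean norm with the sum of the coordinates. *)
Lemma enorm_ball e x y : ball x (e / d.+1%:R) y -> enorm (x - y) <= e.
Proof.
move=> [_ xy]; have d0 : d.+1%:R != 0 :> R by rewrite pnatr_eq0.
apply: (le_trans (enorm_le_sum _)).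
apply: (@le_trans _ _ (\sum_(i < d.+1) (e / d.+1%:R))).
  by apply: ler_sum => i _; rewrite !mxE; apply: ltW; exact: xy.
by rewrite sumr_const card_ord -[_ *+ _]mulr_natr divfK.
Qed.

(** Stability under steps of length less than e makes U both open and closed
    relatively to W. *)
Lemma connected_steps W U (e : R) : 0 < e -> connected W ->
  (forall x y, U x -> W y -> enorm (x - y) < e -> U y) ->
  W `&` U !=set0 -> W `<=` U.
Proof.
move=> e0 cW step WU; pose s := (e / 2 / d.+1%:R : R).
have s0 : 0 < s by rewrite !divr_gt0// ltr0n.
have close x y : ball x s y -> enorm (x - y) < e.
  by move=> /enorm_ball /le_lt_trans; apply; rewrite ltr_pdivrMr// ltr_pMr// ltr1n.
suff <- : W `&` U = W by move=> x [].
apply: cW => //.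
- exists (\bigcup_(x in W `&` U) ball x s).
    by apply: bigcup_open => x _; exact: ball_open.
  apply/seteqP; split => [x [Wx Ux]|x [Wx [y [Wy Uy] yx]]].
    by split => //; exists x => //; exact: ballxx.
  by split => //; apply: step Uy Wx _; exact: close.
- exists (~` \bigcup_(x in W `\` U) ball x s).
    by apply: open_closedC; apply: bigcup_open => x _; exact: ball_open.
  apply/seteqP; split => [x [Wx Ux]|x [Wx nx]].
    split => // -[y [Wy nUy] yx]; apply: nUy.
    by apply: step Ux Wy _; rewrite enorm_distC; exact: close.
  split => //; apply: contrapT => nUx; apply: nx.
  by exists x => //; exact: ballxx.
Qed.

(** U fills each connected piece that it meets, and passes from each piece to
    its neighbours because some pair of points of consecutive pieces is at
    distance less than rho. *)
Lemma rho_connected_steps (rho e : R) W U : 0 <= rho -> rho < e ->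
  rho_connected rho W ->
  (forall x y, U x -> W y -> enorm (x - y) < e -> U y) ->
  W `&` U !=set0 -> W `<=` U.
Proof.
move=> rho0 rhoe [m [A [m0 WA Aco Adist]]] step [w [Ww Uw]].
have e0 : 0 < e by exact: le_lt_trans rhoe.
have AW i x : (i < m)%N -> A i x -> W x by move=> im Ax; rewrite WA; exists i.
have fill i x : (i < m)%N -> A i x -> U x -> A i `<=` U.
  move=> im Ax Ux; apply: (connected_steps e0 (proj2 (Aco i im))).
    by move=> y z Uy Az; apply: step Uy (AW _ _ im Az).
  by exists x.
have next i : (i.+1 < m)%N -> A i `<=` U <-> A i.+1 `<=` U.
  move=> im; have /ereal_inf_lt[_ [[x y] [/= Ax Ay] <-]] := Adist i im.
  rewrite lte_fin => xy; have {}xy := lt_trans xy rhoe.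
  split => [AU|AU].
    apply: (fill _ y) => //; apply: step (AU _ Ax) (AW _ _ im Ay) xy.
  have im' := ltnW im.
  by apply: (fill _ x) => //; apply: step (AU _ Ay) (AW _ _ im' Ax) _;
     rewrite enorm_distC.
have all0 i : (i < m)%N -> A i `<=` U <-> A 0%N `<=` U.
  elim: i => [//|i IH] im; rewrite -IH ?(ltnW im)//.
  by split => /(next i im).
move: Ww; rewrite WA => -[i /= im Aw] x [j /= jm Ax].
have AiU := fill _ _ im Aw Uw.
by apply: (iffRL (all0 j jm)) Ax; apply/(all0 i im).
Qed.

(** Compactness of the closure of W; each of its points is close to a point of W,
    so the centres can be taken in W. *)
Lemma bounded_finite_cover W (s : R) : ebounded W -> 0 < s ->
  exists2 D : seq V, (forall x, x \in D -> W x) &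
    forall y, W y -> exists2 x, x \in D & ball x s y.
Proof.
move=> [M WM] s0.
pose K := [set v : V | forall i, `[- M, M]%classic (v ord0 i)].
have Kco : compact K.
  by apply: (@rV_compact _ _ (fun=> `[- M, M]%classic)) => i; exact: segment_compact.
have WK : W `<=` K.
  move=> x Wx i /=; rewrite in_itv/= -ler_norml; apply: le_trans (WM x Wx).
  rewrite -sqrtr_sqr ler_wsqrtr// (bigD1 i)//= lerDl sumr_ge0// => j _.
  exact: sqr_ge0.
have Kcl : closed K by apply: compact_closed => //; exact: norm_hausdorff.
have cW : compact (closure W).
  apply: subclosed_compact Kco _; first exact: closed_closure.
  by rewrite (closure_id K).1//; exact: closureS.
move: cW; rewrite compact_cover => /(_ V W (fun x => ball x s)) [].
- by move=> x _; exact: ball_open.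
- move=> x /(_ _ (nbhsx_ballx x s s0)) [y [Wy xy]].
  by exists y => //; exact: ball_sym.
move=> D DW cover; exists (finmap.enum_fset D) => [x xD|y Wy].
  by have := DW x xD; rewrite inE.
by have [x xD xy] := cover y (subset_closure Wy); exists x.
Qed.

(** In an open set the diameter is not attained: if x and y are distinct, x can be
    pushed slightly away from y inside W. *)
Lemma open_diam_lt W (r : R) x y : open W -> 0 < r ->
  (ediam W <= r%:E)%E -> W x -> W y -> enorm (x - y) < r.
Proof.
move=> oW r0 diam Wx Wy.
have dist z : W z -> enorm (z - y) <= r.
  move=> Wz; rewrite -lee_fin; apply: le_trans diam.
  by apply: ereal_sup_ubound; exists (z, y).
have [->|xy0] := eqVneq (enorm (x - y)) 0; first by [].
have xyp : 0 < enorm (x - y) by rewrite lt0r xy0 enorm_ge0.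
move: oW; rewrite openE => /(_ x Wx) /nbhs_ballP[e /= e0 eW].
pose n := (\sum_i `|(x - y) ord0 i|).
have n0 : 0 <= n by exact: sumr_ge0.
pose t := (e / (n + 1)).
have t0 : 0 < t by rewrite divr_gt0// ltr_wpDl.
have : W (x + t *: (x - y)).
  apply: eW; split => // i j; rewrite ord1 /ball/= !mxE opprD addNKr normrN normrM.
  have nj : `|x ord0 j - y ord0 j| <= n.
    by rewrite /n (bigD1 j)//= !mxE lerDl sumr_ge0.
  rewrite gtr0_norm//; apply: (le_lt_trans (ler_wpM2l (ltW t0) nj)).
  have -> : e = t * (n + 1) by rewrite /t divfK// gt_eqF// ltr_wpDl.
  by rewrite ltr_pM2l// ltrDl.
move=> /dist.
have -> : x + t *: (x - y) - y = (1 + t) *: (x - y).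
  by rewrite scalerDl scale1r addrAC.
rewrite enormZ ger0_norm; last by rewrite addr_ge0// ltW.
by apply: lt_le_trans; rewrite mulrDl mul1r ltrDl mulr_gt0.
Qed.

End euclidean_geometry.

(** * The Poincare inequality *)

Section euclidean_kernel.
Context (R : realType) (d : nat).
Local Notation V := 'rV[R]_d.+1.
Local Notation leb := (@lebesgue R d).
Implicit Types (Omega F G : set V) (p r : R) (nu u w : V -> R).
Local Open Scope ereal_scope.

Lemma Lp_norm_poweR Omega p w : (0 < p)%R ->
  Lp_norm Omega p w `^ p = \int[leb]_(x in Omega) (`|w x| `^ p)%:E.
Proof.
move=> p0; rewrite /Lp_norm unlock -poweRrM mulVf ?gt_eqF// poweRe1; last first.
  by apply: integral_ge0 => x _; exact: poweR_ge0.
rewrite [RHS]integral_mkcond; apply: eq_integral => x _.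
rewrite !patchE; case: ifPn => // _.
by rewrite abse0 poweR0r// gt_eqF.
Qed.

(** The essential infimum is infinite when A is null; any positive constant is
    then a lower bound. *)
Lemma ess_inf_on_gt0 (A : set V) nu : 0 < ess_inf_on A (EFin \o nu) ->
  exists2 kappa : R, (0 < kappa)%R &
    {ae leb, forall h, A h -> (kappa <= nu h)%R}.
Proof.
move=> /ereal_sup_gt[[y| |] //= Ay y0].
- by exists y; rewrite -?lte_fin//; apply: filterS Ay => h /[apply].
- exists 1%R => //; apply: filterS Ay => h /[apply].
  by rewrite leye_eq.
Qed.

Lemma kernel_link_near nu (kappa r : R) G F :
  {ae leb, forall h, (eball r `\ (0%R : V)) h -> (kappa <= nu h)%R} ->
  (forall x y, G x -> F y -> (enorm (x - y) < r)%R) ->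
  kernel_link leb (fun x y => nu (x - y)%R) kappa G F.
Proof.
move=> nu_ge near x Gx; apply: filterS (ae_reflect x nu_ge) => y H Fy xy.
apply: H; split; first exact: near.
by move/eqP; rewrite subr_eq0 => /eqP.
Qed.

End euclidean_kernel.

Unset Implicit Arguments.

Theorem theorem7p8 (R : realType) (d : nat) (p : R)
    (Omega : set 'rV[R]_d.+1) (nu : 'rV[R]_d.+1 -> R) (r : R)
    (hp : 1 <= p)
    (Omega_open : open Omega) (Omega_bounded : ebounded Omega)
    (* nu is only constrained on R^(d+1) minus the origin *)
    (nu_ge0 : forall h : 'rV[R]_d.+1, h != 0 -> 0 <= nu h)
    (nu_measurable : measurable_fun [set~ (0 : 'rV[R]_d.+1)] nu)
    (nu_sym : forall h : 'rV[R]_d.+1, h != 0 -> nu (- h) = nu h)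
    (hr : 0 < r)
    (kappa_gt0 : (0 < ess_inf_on (eball r `\ (0%R : 'rV[R]_d.+1)) (EFin \o nu))%E)
    (hOmega : (ediam Omega <= r%:E)%E \/
              exists rho : R, [/\ 0 <= rho, rho < r & rho_connected rho Omega]) :
  exists C : R, 0 < C /\
    forall u : 'rV[R]_d.+1 -> R, in_Lp Omega p u ->
      ((Lp_norm Omega p (fun x => u x - mean Omega u)%R) `^ p
         <= C%:E * energy Omega p nu u)%E.
Proof.
set leb := @lebesgue R d; pose k x y : R := nu (x - y).
have p0 : 0 < p by exact: lt_le_trans hp.
have mO : measurable Omega by exact: open_lebesgue_measurable.
have Ooo : (leb Omega < +oo)%E by exact: lebesgue_bounded_lty.
have k_ge0 x y : x <> y -> 0 <= k x y.
  by move=> /eqP xy; apply: nu_ge0; rewrite subr_eq0.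
have [kappa kappa0 nu_ge] := ess_inf_on_gt0 kappa_gt0.
pose ctrl c S := controlled leb p Omega k c S.
suff [C C0 HC] : ctrl (average leb Omega) Omega.
  exists C; split => // u [mu_ Lu]; rewrite Lp_norm_poweR//; apply: HC; split => //.
  by rewrite -Lp_norm_poweR// poweR_lty.
have [->|/set0P[x0 Ox0]] := eqVneq Omega set0; first exact: controlled0.
have Op : (0 < leb Omega)%E by apply: lebesgue_open_gt0 => //; exists x0.
case: hOmega => [diam|[rho [rho0 rhor conn]]].
  apply: (controlled_average hp mO Ooo k_ge0 kappa0) => //.
  by apply: (kernel_link_near nu_ge) => x y; exact: open_diam_lt.
(* Points of E x and E y are at distance less than r as soon as the centres are
   at distance less than rho + s: each ball adds at most s. *)
pose s := (r - rho) / 3; pose del := s / d.+1%:R.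
have s0 : 0 < s by rewrite divr_gt0// subr_gt0.
have del0 : 0 < del by rewrite divr_gt0// ltr0n.
pose E x := ball x del `&` Omega.
have oE x : open (E x) by apply: openI => //; exact: ball_open.
have mE x : measurable (E x) by exact: open_lebesgue_measurable.
have EO x : E x `<=` Omega by move=> y [].
have E_gt0 x : Omega x -> (0 < leb (E x))%E.
  by move=> Ox; apply: lebesgue_open_gt0 => //; exists x; split => //; exact: ballxx.
have link x y : enorm (x - y) < rho + s -> kernel_link leb k kappa (E x) (E y).
  move=> xy; apply: (kernel_link_near nu_ge) => a b [/enorm_ball xa _] [/enorm_ball yb _].
  apply: le_lt_trans (enorm_distD a x b) _.
  apply: le_lt_trans (lerD (lexx _) (enorm_distD x y b)) _.
  by rewrite enorm_distC; move: xa yb xy; rewrite /s; lra.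
pose c := average leb (E x0).
have c0 : ctrl c (E x0).
  apply: (controlled_average hp mO Ooo k_ge0 kappa0) => //; first exact: E_gt0.
  by apply: link; rewrite subrr -(scale0r 0) enormZ normr0 mul0r ltr_wpDl.
have all_c : Omega `<=` [set x | Omega x /\ ctrl c (E x)].
  have rhos : rho < rho + s by rewrite ltrDl.
  apply: (rho_connected_steps rho0 rhos conn) => [|].
  - move=> x y [Ox cx] Oy xy; split; first exact: Oy.
    have yx : enorm (y - x) < rho + s by rewrite enorm_distC.
    exact: (controlled_link hp mO Ooo k_ge0 kappa0 (mE y) (EO y) (mE x) (EO x)
      (E_gt0 _ Ox) (link _ _ yx) cx).
  - by exists x0.
suff : ctrl c Omega by exact: controlled_average_Omega.
(* The deviation from c on Omega is at most the sum over a finite cover. *)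
have [D DO cover] := bounded_finite_cover Omega_bounded del0.
suff : ctrl c (\big[setU/set0]_(x <- D) E x).
  apply: controlledS.
  move=> y Oy; have [x xD xy] := cover y Oy.
  by rewrite -bigcup_seq; exists x => //; split.
have {DO} : forall x, x \in D -> ctrl c (E x) by move=> x /DO /all_c [].
elim: D {cover} => [_|x D IH cD]; first by rewrite big_nil; exact: controlled0.
rewrite big_cons; apply: (controlledU mO Ooo (mE x) _ (EO x)).
- exact: bigsetU_measurable.
- by rewrite -bigcup_seq => y [z _ []].
- by apply: cD; rewrite mem_head.
- by apply: IH => z zD; apply: cD; rewrite in_cons zD orbT.
Qed.
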